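(* Let $\theta=0.427373\ldots$ be the largest real root of $\theta^3+\theta^2-\theta+\frac16=0$ and let $\rho=6\theta^2(1-2\theta)=0.159181\ldots$. Let $\mathcal G=(G_n)$ be a sequence of finite graphs with $|V(G_n)|\to\infty$ such that $\limsup_n p_0(G_n)<\rho$ and $\limsup_n p_3(G_n)<\rho$. Then $\mathcal G$ is $3$-universal, i.e. $\liminf_n p(H,G_n)>0$ for every graph $H$ on $3$ vertices. Moreover, the bound is tight: there is a sequence $\mathcal G$ with $\lim_n p_0(G_n)=\lim_n p_3(G_n)=\rho$ that is not $3$-universal.
   Context: For a fixed $l$-vertex graph $H$ and a graph $G$ with at least $l$ vertices, $p(H,G)$ denotes the probability that a uniformly random $l$-element subset of $V(G)$ induces a subgraph isomorphic to $H$. For $i=0,1,2,3$, $P_i$ denotes the unique (up to isomorphism) $3$-vertex graph with exactly $i$ edges, and $p_i(G)=p(P_i,G)$. A sequence of graphs $\mathcal G=(G_n)$ with $|V(G_n)|\to\infty$ is called $l$-universal if $\liminf_n p(H,G_n)>0$ for every graph $H$ on $l$ vertices. *)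

(* Defs.v *)
From mathcomp Require Import all_boot all_order all_algebra.
From mathcomp Require Import all_classical all_reals all_analysis.
From mathcomp Require Import ring lra.

Set Implicit Arguments.
Unset Strict Implicit.
Unset Printing Implicit Defensive.

Import Order.TTheory GRing.Theory Num.Theory.
Import numFieldNormedType.Exports.

Local Open Scope ring_scope.

Record graph := Graph {
  vertex :> finType;
  edge : rel vertex;
  edge_sym : symmetric edge;
  edge_irr : irreflexive edge }.

Definition isomorphic (G H : graph) : Prop :=
  exists2 f : G -> H, bijective f & forall x y, edge (f x) (f y) = edge x y.

Section Induced.
Variables (G : graph) (S : {set G}).

Let iedge (x y : {x : G | x \in S}) := edge (val x) (val y).
Let iedge_sym : symmetric iedge. Proof. by move=> x y; exact: edge_sym. Qed.
Let iedge_irr : irreflexive iedge. Proof. by move=> x; exact: edge_irr. Qed.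

Definition induced := Graph iedge_sym iedge_irr.
End Induced.

(* When G has fewer vertices than H, the denominator and hence the quotient
   are 0; along a sequence with |V(G_n)| -> oo this affects only finitely many
   terms. *)
Definition pr (R : realType) (H G : graph) : R :=
  #|[set S : {set G} | (#|S| == #|H|) && `[< isomorphic (induced S) H >]]|%:R
  / 'C(#|G|, #|H|)%:R.

(* Each edge {x, y} of the complete graph on {0, 1, 2} is numbered by the third
   vertex 3 - (x + y); P3 i consists of the edges with number less than i. *)
Section ThreeVertices.
Variable i : nat.

Let pedge (x y : 'I_3) := (x != y) && (3 - (x + y) < i)%N.
Let pedge_sym : symmetric pedge.
Proof. by move=> x y; rewrite /pedge eq_sym addnC. Qed.
Let pedge_irr : irreflexive pedge.
Proof. by move=> x; rewrite /pedge eqxx. Qed.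

Definition P3 := Graph pedge_sym pedge_irr.
End ThreeVertices.

Definition universal (R : realType) (l : nat) (G : nat -> graph) : Prop :=
  forall H : graph, #|H| = l -> 0 < limn_inf (fun n => pr R H (G n)).

Definition is_largest_root (R : realType) (f : R -> R) (t : R) : Prop :=
  f t = 0 /\ forall x, f x = 0 -> x <= t.

(* The remaining facts only validate the definitions: P3 i is the unique
   3-vertex graph with i edges, pr takes values in [0, 1] (so that the limits
   in limn_inf and limn_sup exist), and the cubic has a largest root. *)

Definition nb_edges (G : graph) : nat :=
  #|[set xy : G * G | edge xy.1 xy.2]|./2.

Lemma nb_edgesE (G : graph) (g : 'I_3 -> G) : bijective g ->
  nb_edges G = (edge (g 0%R) (g 1%R) + edge (g 0%R) (g 2%R) + edge (g 1%R) (g 2%R))%N.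
Proof.
move=> bg; rewrite /nb_edges cardsE -sum1_card.
rewrite (eq_bigl (fun xy : G * G => true && edge xy.1 xy.2)) //.
rewrite -(pair_big_dep xpredT (fun x y => edge x y) (fun _ _ => 1%N)) /=.
rewrite (reindex g) /=; last exact: onW_bij.
under eq_bigr => x _.
  rewrite big_mkcond (reindex g) /=; last exact: onW_bij.
  over.
rewrite !big_ord_recl !big_ord0 /=.
have -> : lift ord0 ord0 = 1%R :> 'I_3 by apply/val_inj.
have -> : lift ord0 (lift ord0 ord0) = 2%R :> 'I_3 by apply/val_inj.
have -> : ord0 = 0%R :> 'I_3 by apply/val_inj.
rewrite !edge_irr (edge_sym (g 1%R) (g 0%R)) (edge_sym (g 2%R) (g 0%R)).
rewrite (edge_sym (g 2%R) (g 1%R)).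
by case: edge; case: edge; case: edge.
Qed.

Lemma card_P33 i : #|P3 i| = 3%N. Proof. exact: card_ord. Qed.

Lemma nb_edges_P33 i : (i <= 3)%N -> nb_edges (P3 i) = i.
Proof.
have bid : bijective (id : 'I_3 -> P3 i) by exists id.
by rewrite (nb_edgesE bid); case: i {bid} => [|[|[|[|]]]].
Qed.

Lemma isomorphic_P3 (G : graph) :
  #|G| = 3%N -> isomorphic G (P3 (nb_edges G)).
Proof.
move=> G3.
pose g0 (x : 'I_3) : G := enum_val (cast_ord (esym G3) x).
have bg0 : bijective g0.
  exists (fun x => cast_ord G3 (enum_rank x)) => x.
    by rewrite /g0 enum_valK cast_ordKV.
  by rewrite /g0 cast_ordK enum_rankK.
suff [g bg eg] : exists2 g : 'I_3 -> G, bijective g &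
    forall x y, edge (g x) (g y) = @edge (P3 (nb_edges G)) x y.
  case: bg => h gK hK; exists h; first by exists g.
  by move=> x y; rewrite -eg !hK.
rewrite (nb_edgesE bg0).
have sym01 := edge_sym (g0 1%R) (g0 0%R).
have sym02 := edge_sym (g0 2%R) (g0 0%R).
have sym12 := edge_sym (g0 2%R) (g0 1%R).
have perm_case (s t : 'I_3 -> 'I_3) : cancel s t -> cancel t s ->
  bijective (g0 \o s).
  by move=> st ts; apply: bij_comp bg0 _; exists t.
pose sw (a b x : 'I_3) := if x == a then b else if x == b then a else x.
have swK a b : cancel (sw a b) (sw a b).
  move=> x; rewrite /sw; case: (eqVneq x a) => [->|xa].
    by rewrite eqxx; case: eqVneq.
  by case: (eqVneq x b) => [->|xb]; rewrite ?eqxx // (negPf xa) (negPf xb).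
have key (a b i j k : 'I_3) n :
    [&& sw a b 0%R == i, sw a b 1%R == j & sw a b 2%R == k] ->
    edge (g0 i) (g0 j) = (2 < n)%N -> edge (g0 i) (g0 k) = (1 < n)%N ->
    edge (g0 j) (g0 k) = (0 < n)%N ->
    exists2 g : 'I_3 -> G, bijective g &
      forall x y, edge (g x) (g y) = @edge (P3 n) x y.
  case/and3P => /eqP <- /eqP <- /eqP <- h01 h02 h12.
  exists (g0 \o sw a b); first exact: perm_case (swK a b) (swK a b).
  have H (x y : 'I_3) : (x < y)%N ->
      edge (g0 (sw a b x)) (g0 (sw a b y)) = @edge (P3 n) x y.
    case: x y => [[|[|[|//]]] ix] [[|[|[|//]]] iy] //= _.
    - by rewrite -[RHS]h01; congr (edge (g0 (sw a b _)) (g0 (sw a b _)));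
        apply/val_inj.
    - by rewrite -[RHS]h02; congr (edge (g0 (sw a b _)) (g0 (sw a b _)));
        apply/val_inj.
    - by rewrite -[RHS]h12; congr (edge (g0 (sw a b _)) (g0 (sw a b _)));
        apply/val_inj.
  move=> x y; have [xy|yx|/val_inj->] := ltngtP x y; first exact: H.
    by rewrite edge_sym H // edge_sym.
  by rewrite /= edge_irr eqxx.
case e01: (edge (g0 0%R) (g0 1%R)); case e02: (edge (g0 0%R) (g0 2%R));
case e12: (edge (g0 1%R) (g0 2%R)); rewrite /=;
first [ by apply: (key 0%R 0%R 0%R 1%R 2%R); rewrite ?sym01 ?sym02 ?sym12
      | by apply: (key 0%R 1%R 1%R 0%R 2%R); rewrite ?sym01 ?sym02 ?sym12
      | by apply: (key 0%R 2%R 2%R 1%R 0%R); rewrite ?sym01 ?sym02 ?sym12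
      | by apply: (key 1%R 2%R 0%R 2%R 1%R); rewrite ?sym01 ?sym02 ?sym12 ].
Qed.

Lemma pr_ge0 (R : realType) (H G : graph) : 0 <= pr R H G.
Proof. by rewrite divr_ge0. Qed.

Lemma pr_le1 (R : realType) (H G : graph) : pr R H G <= 1.
Proof.
rewrite /pr; case: (posnP 'C(#|G|, #|H|)) => [->|C0].
  by rewrite invr0 mulr0.
rewrite ler_pdivrMr ?ltr0n // mul1r ler_nat.
rewrite -card_draws; apply: subset_leq_card; apply/fintype.subsetP => S.
by rewrite !inE => /andP[].
Qed.

Lemma largest_root_exists (R : realType) : exists t : R,
  is_largest_root (fun x : R => x ^+ 3 + x ^+ 2 - x + 1 / 6) t.
Proof.
pose q : {poly R} := 'X^3 + 'X^2 - 'X + (1 / 6)%:P.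
have qE x : q.[x] = x ^+ 3 + x ^+ 2 - x + 1 / 6 by rewrite /q !hornerE.
have ab : 42 / 100 <= 43 / 100 :> R by lra.
have [|t /andP[t1 t2] /rootP rt] := @poly_ivt R q _ _ ab.
  by rewrite !qE; apply/andP; split; lra.
rewrite qE in rt; exists t; split=> // x rx.
rewrite leNgt; apply/negP => tx.
have : (x - t) * (x ^+ 2 + x * t + t ^+ 2 + x + t - 1) = 0.
  transitivity ((x ^+ 3 + x ^+ 2 - x + 1 / 6)
              - (t ^+ 3 + t ^+ 2 - t + 1 / 6)); first by field.
  by rewrite rx rt subrr.
move/eqP; rewrite mulf_eq0 subr_eq0 gt_eqF //=.
by apply/negP; rewrite gt_eqF //; nra.
Qed.

(* Main.v *)
Require Import Defs.
From mathcomp Require Import all_boot all_order all_algebra.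
From mathcomp Require Import all_classical all_reals all_analysis.
From mathcomp Require Import ring lra zify.

(* If p_1 is small, then "x = y or xy is not an edge" is almost transitive, i.e.
   G is almost complete multipartite. Exactly complete multipartite graphs with
   relative part sizes x_i have p_0 = sum x_i^3 = 1 - 3 e_2 + 3 e_3 and
   p_3 = 6 e_3. Removing one part of size a from e_1 = 1, e_2 and e_3 gives
   e_3 >= a^3 - a^2 + e_2 a, so that p_3 <= rho implies
     p_0 >= rho + 3 (a - theta)^2 (a + 2 theta - 1) / a,
   and if all parts are smaller than 1 - 2 theta, then p_3 is large.
   The same count works without any removal lemma: in a graph with few induced
   copies of P_1, some vertex v has few copies at v and a large set A of
   non-neighbours, and A plays the role of the part of size a. Complementing
   the graph handles p_2, and Goodman's bound p_0 + p_3 >= 1/4 handles p_0 and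
   p_3. Equality holds for parts of sizes theta, theta, 1 - 2 theta. *)

Set Implicit Arguments.
Unset Strict Implicit.
Unset Printing Implicit Defensive.

Import Order.TTheory GRing.Theory Num.Theory.
Import numFieldNormedType.Exports.

Local Open Scope ring_scope.

(** * Sums over ordered triples *)

Section TripleSums.
Variables (R : realType) (V : finType).
Implicit Types f : V -> V -> V -> R.

Definition sum3 f : R := \sum_x \sum_y \sum_z f x y z.

Lemma eq_sum3 f g : (forall x y z, f x y z = g x y z) -> sum3 f = sum3 g.
Proof.
move=> fg; apply: eq_bigr => x _; apply: eq_bigr => y _.
by apply: eq_bigr => z _.
Qed.

Lemma ler_sum3 f g : (forall x y z, f x y z <= g x y z) -> sum3 f <= sum3 g.
Proof.
move=> fg; apply: ler_sum => x _; apply: ler_sum => y _.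
by apply: ler_sum => z _.
Qed.

Lemma sum3_ge0 f : (forall x y z, 0 <= f x y z) -> 0 <= sum3 f.
Proof. by move=> f0; do 3![apply: sumr_ge0 => ? _]. Qed.

Lemma sum3D f g : sum3 (fun x y z => f x y z + g x y z) = sum3 f + sum3 g.
Proof.
rewrite /sum3 -big_split; apply: eq_bigr => x _; rewrite -big_split.
by apply: eq_bigr => y _; rewrite -big_split.
Qed.

Lemma sum3Z k f : sum3 (fun x y z => k * f x y z) = k * sum3 f.
Proof.
rewrite /sum3 mulr_sumr; apply: eq_bigr => x _; rewrite mulr_sumr.
by apply: eq_bigr => y _; rewrite mulr_sumr.
Qed.

Lemma sum3N f : sum3 (fun x y z => - f x y z) = - sum3 f.
Proof.
by rewrite -mulN1r -sum3Z; apply: eq_sum3 => x y z; rewrite mulN1r.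
Qed.

Lemma sum3B f g : sum3 (fun x y z => f x y z - g x y z) = sum3 f - sum3 g.
Proof. by rewrite sum3D sum3N. Qed.

Lemma sum3C12 f : sum3 f = sum3 (fun x y z => f y x z).
Proof. exact: exchange_big. Qed.

Lemma sum3C23 f : sum3 f = sum3 (fun x y z => f x z y).
Proof. by apply: eq_bigr => x _; exact: exchange_big. Qed.

Lemma sum3M (g : V -> R) (h : V -> V -> R) :
  sum3 (fun x y z => g x * h y z) = (\sum_x g x) * \sum_y \sum_z h y z.
Proof.
rewrite mulr_suml; apply: eq_bigr => x _; rewrite mulr_sumr.
by apply: eq_bigr => y _; rewrite mulr_sumr.
Qed.

Lemma sum3_cst (k : R) : sum3 (fun _ _ _ => k) = #|V|%:R ^+ 3 * k.
Proof.
rewrite (eq_sum3 (g := fun x y z => 1 * k)); last by move=> *; rewrite mul1r.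
rewrite (@sum3M (fun=> 1) (fun _ _ => k)) !sumr_const -!mulrnA.
rewrite !exprS expr0 -[_ *+ (#|V| * _)]mulr_natl natrM; ring.
Qed.

End TripleSums.

(** * Triple counts for a symmetric relation *)

Section Densities.
Variables (R : realType) (V : finType) (u : rel V).
Hypothesis symu : symmetric u.

Let r (x y : V) : R := (u x y)%:R.
Let n : R := #|V|%:R.

(** The relation [u] will be that of lying in the same part. So for a complete multipartite graph
    [ntri] counts independent triples and [nindep] counts triangles, while [ncherry] counts failures
    of transitivity. Triples are ordered and may repeat a vertex. *)
Definition nedge : R := \sum_x \sum_y r x y.
Definition ntri : R := sum3 (fun x y z => r x y * r x z * r y z).
Definition nindep : R :=
  sum3 (fun x y z => (1 - r x y) * (1 - r x z) * (1 - r y z)).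
Definition ncherry : R := sum3 (fun x y z => r x y * r x z * (1 - r y z)).

Let rC x y : r x y = r y x. Proof. by rewrite /r symu. Qed.
Let r01 x y : r x y = 0 \/ r x y = 1.
Proof. by rewrite /r; case: u; [right|left]. Qed.
Let r_ge0 x y : 0 <= r x y. Proof. by case: (r01 x y) => ->. Qed.
Let r_le1 x y : r x y <= 1.
Proof. by case: (r01 x y) => ->; rewrite ?ler01. Qed.

Lemma ntri_ge0 : 0 <= ntri.
Proof. by apply: sum3_ge0 => x y z; rewrite !mulr_ge0. Qed.

Lemma ncherry_ge0 : 0 <= ncherry.
Proof. by apply: sum3_ge0 => x y z; rewrite !mulr_ge0 ?subr_ge0. Qed.

Lemma sum3_edge : sum3 (fun x y z => r x y) = n * nedge.
Proof.
rewrite sum3C23 sum3C12.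
rewrite (eq_sum3 (g := fun x y z => 1 * r y z)); last first.
  by move=> *; rewrite mul1r.
by rewrite (sum3M (fun=> 1)) sumr_const.
Qed.

Lemma sum3_cherry : sum3 (fun x y z => r x y * r x z * (1 - r y z)
    + r x y * r y z * (1 - r x z) + r x z * r y z * (1 - r x y))
  = 3 * ncherry.
Proof.
have c2 : sum3 (fun x y z => r x y * r y z * (1 - r x z)) = ncherry.
  by rewrite sum3C12; apply: eq_sum3 => x y z; rewrite (rC y x).
have c3 : sum3 (fun x y z => r x z * r y z * (1 - r x y)) = ncherry.
  by rewrite sum3C23 -c2; apply: eq_sum3 => x y z; rewrite (rC z y).
by rewrite !sum3D c2 c3 -/ncherry; ring.
Qed.

(** The sum of the pairwise products of three indicators is the indicator that exactly two hold plus
    3 times the triple product; this turns the coefficient -1 of inclusion-exclusion into 2. *)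
Lemma nindepE : nindep = n ^+ 3 - 3 * n * nedge + 2 * ntri + 3 * ncherry.
Proof.
have e13 : sum3 (fun x y z => r x z) = n * nedge by rewrite sum3C23 sum3_edge.
have e23 : sum3 (fun x y z => r y z) = n * nedge by rewrite sum3C12 e13.
rewrite -sum3_cherry /nindep (eq_sum3 (g := fun x y z =>
   1 - r x y - r x z - r y z + 2 * (r x y * r x z * r y z)
   + (r x y * r x z * (1 - r y z) + r x y * r y z * (1 - r x z)
      + r x z * r y z * (1 - r x y)))); last by move=> x y z; ring.
rewrite sum3D sum3D sum3B sum3B sum3B sum3Z sum3_cst e13 e23 sum3_edge.
by rewrite -/ntri -/n; ring.
Qed.

(** By [nindepE] the right-hand side depends only on the degrees, whose squares sum to
    [ntri + ncherry]. What remains is that the squared deviations of the degrees from [n / 2] have a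
    non-negative sum. *)
Lemma goodman : n ^+ 3 / 4 <= nindep + ntri.
Proof.
have degsq : \sum_x (\sum_y r x y) ^+ 2 = ntri + ncherry.
  rewrite -sum3D; apply: eq_bigr => x _.
  rewrite expr2 mulr_suml; apply: eq_bigr => y _; rewrite mulr_sumr.
  by apply: eq_bigr => z _; ring.
have : 0 <= \sum_x ((\sum_y r x y) - n / 2) ^+ 2.
  by apply: sumr_ge0 => x _; rewrite sqr_ge0.
rewrite (eq_bigr (fun x => (\sum_y r x y) ^+ 2
  + ((- n) * (\sum_y r x y) + n ^+ 2 / 4))); last by move=> x _; field.
rewrite big_split big_split /= degsq -mulr_sumr sumr_const -/nedge.
rewrite nindepE -[_ *+ #|V|]mulr_natr -/n => h; lra.
Qed.

(** * The neighbourhood of one vertex in the role of a part *)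

Section Neighborhood.
Variable v : V.
Let a x := r v x.
Let b x := 1 - r v x.

Definition deg : R := \sum_x r v x.
(** This and [edges_across] count the cherries with [v] as centre and with [v] as an end. Their sum
    is the defect of [v]; it is 0 when [u] is an equivalence relation. *)
Definition nonedges_in : R := \sum_y \sum_z r v y * r v z * (1 - r y z).
Definition edges_across : R := \sum_y \sum_z r v y * (1 - r v z) * r y z.
Let nonedges_out : R := \sum_y \sum_z b y * b z * (1 - r y z).

Lemma deg_ge0 : 0 <= deg. Proof. exact: sumr_ge0. Qed.

Lemma deg_le : deg <= n.
Proof. by rewrite /n -sumr_const; apply: ler_sum => x _. Qed.

Lemma nonedges_in_ge0 : 0 <= nonedges_in.
Proof. by do 2![apply: sumr_ge0 => ? _]; rewrite !mulr_ge0 ?subr_ge0. Qed.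

Lemma edges_across_ge0 : 0 <= edges_across.
Proof. by do 2![apply: sumr_ge0 => ? _]; rewrite !mulr_ge0 ?subr_ge0. Qed.

Let sum_b : \sum_x b x = n - deg.
Proof. by rewrite sumrB sumr_const. Qed.

(** Only pairs on the same side of the neighbourhood of [v] are kept; on each side the related pairs
    are all pairs minus the unrelated ones. *)
Let nedge_ge :
  deg ^+ 2 - nonedges_in + ((n - deg) ^+ 2 - nonedges_out) <= nedge.
Proof.
rewrite -sum_b /deg !expr2 !mulr_suml -!sumrB -big_split.
apply: ler_sum => x _; rewrite !mulr_sumr -!sumrB -big_split.
apply: ler_sum => y _; rewrite /b /=.
case: (r01 v x) => ->; case: (r01 v y) => ->; case: (r01 x y) => ->; lra.
Qed.

(** Counts triples with exactly one vertex in the neighbourhood of [v], which can stand in three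
    positions, whence the factor 3. For an unrelated pair outside, the union bound subtracts its
    relations to the inner vertex. *)
Let nindep_ge :
  3 * (deg * nonedges_out - 2 * (n - deg) * edges_across) <= nindep.
Proof.
pose g x y z := a x * b y * b z * ((1 - r y z) - r x y - r x z).
have sg : sum3 g = deg * nonedges_out - 2 * (n - deg) * edges_across.
  rewrite (eq_sum3 (g := fun x y z => a x * (b y * b z * (1 - r y z))
     - b z * (a x * b y * r x y) - b y * (a x * b z * r x z))); last first.
    by move=> x y z; rewrite /g; ring.
  have h : sum3 (fun x y z => b y * (a x * b z * r x z))
         = (n - deg) * edges_across.
    by rewrite sum3C12 sum3M sum_b.
  rewrite !sum3B h (sum3C23 (fun x y z => b z * _)) h sum3M.
  by rewrite -/deg -/nonedges_out; ring.
rewrite -sg.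
have -> : 3 * sum3 g = sum3 (fun x y z => g x y z + g y x z + g z y x).
  rewrite !sum3D -(sum3C12 g).
  have -> : sum3 (fun x y z => g z y x) = sum3 g.
    by rewrite sum3C12 sum3C23 sum3C12.
  ring.
apply: ler_sum3 => x y z; rewrite /g /a /b (rC y x) (rC z x) (rC z y).
case: (r01 v x) => ->; case: (r01 v y) => ->; case: (r01 v z) => ->;
case: (r01 x y) => ->; case: (r01 x z) => ->; case: (r01 y z) => ->; lra.
Qed.

(* When u is an equivalence relation and a = deg is the size of the class of v,
   the error terms vanish and this is e_3 >= a^3 - n a^2 + e_2 a for the
   elementary symmetric functions of the class sizes. *)
Lemma ntri_ge : (deg - n) * nindep - deg * n ^+ 3
    + 3 * n * deg * (deg ^+ 2 + (n - deg) ^+ 2)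
    - 3 * n * deg * nonedges_in - 6 * n * (n - deg) * edges_across
    - 3 * deg * ncherry
  <= 2 * deg * ntri.
Proof.
have h1 := nindepE.
have n0 : 0 <= n by [].
have h2 : 0 <= n * deg * (nedge
    - (deg ^+ 2 - nonedges_in + ((n - deg) ^+ 2 - nonedges_out))).
  by rewrite !mulr_ge0 ?deg_ge0 // subr_ge0.
have h3 : 0 <= n * (nindep
    - 3 * (deg * nonedges_out - 2 * (n - deg) * edges_across)).
  by rewrite mulr_ge0 // subr_ge0.
rewrite -subr_ge0.
(* The slacks of [nedge_ge] and [nindep_ge] enter with weights [3 n deg] and [n], for which
   [nonedges_out] cancels. *)
suff -> : 2 * deg * ntri - ((deg - n) * nindep - deg * n ^+ 3
    + 3 * n * deg * (deg ^+ 2 + (n - deg) ^+ 2)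
    - 3 * n * deg * nonedges_in - 6 * n * (n - deg) * edges_across
    - 3 * deg * ncherry) = 3 * (n * deg * (nedge
    - (deg ^+ 2 - nonedges_in + ((n - deg) ^+ 2 - nonedges_out))))
    + n * (nindep
    - 3 * (deg * nonedges_out - 2 * (n - deg) * edges_across)) by lra.
have -> : ntri = (nindep - n ^+ 3 + 3 * n * nedge - 3 * ncherry) / 2 by lra.
by field.
Qed.

End Neighborhood.

Lemma sum_nonedges_in : \sum_v nonedges_in v = ncherry.
Proof. by []. Qed.

Lemma sum_edges_across : \sum_v edges_across v = ncherry.
Proof.
rewrite /edges_across -/(sum3 (fun v y z => r v y * (1 - r v z) * r y z)).
by rewrite sum3C12; apply: eq_sum3 => x y z; rewrite (rC y x); ring.
Qed.

(** Averaging: otherwise every degree is at most [n / 5] plus the defect divided by [eta n].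
    Summing, [nedge] is at most [(1/5 + 2 eta) n^2 <= (11/50) n^2], and then [nindepE] gives
    [nindep >= (17/50) n^3], a contradiction. *)
Lemma exists_good_vertex (eta : R) : 0 < eta -> eta <= 1 / 100 ->
  ncherry <= eta ^+ 2 * n ^+ 3 -> nindep < n ^+ 3 / 5 ->
  exists v, n / 5 <= deg v /\ nonedges_in v + edges_across v <= eta * n ^+ 2.
Proof.
move=> e0 e1 hC hI.
have n0 : 0 < n.
  rewrite lt0r; apply/andP; split => //; apply/eqP => nz.
  move: hI; have := ntri_ge0; have := ncherry_ge0; rewrite nindepE nz; lra.
apply: contrapT => nex.
have key v : deg v <= n / 5 + (nonedges_in v + edges_across v) / (eta * n).
  have dn := deg_le v.
  have en : 0 < eta * n by rewrite mulr_gt0.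
  have C0 := nonedges_in_ge0 v; have D0 := edges_across_ge0 v.
  case: (leP (n / 5) (deg v)) => [dv|/ltW dv]; last first.
    by rewrite (le_trans dv) // lerDl divr_ge0 ?addr_ge0 // ltW.
  case: (leP (nonedges_in v + edges_across v) (eta * n ^+ 2)) => [cv|/ltW cv].
    by case: nex; exists v.
  suff : n <= (nonedges_in v + edges_across v) / (eta * n) by lra.
  by rewrite ler_pdivlMr // mulrCA -expr2.
have : nedge <= n * (n / 5) + 2 * ncherry / (eta * n).
  have : nedge <= \sum_v (n / 5 + (nonedges_in v + edges_across v) / (eta * n)).
    by apply: ler_sum => v _; exact: key.
  move/le_trans; apply.
  rewrite big_split /= sumr_const -mulr_suml big_split /=.
  rewrite sum_nonedges_in sum_edges_across -[_ *+ #|V|]mulr_natl -/n.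
  by rewrite -mulr2n mulr_natl.
move=> hE.
have : 2 * ncherry / (eta * n) <= 2 * eta * n ^+ 2.
  rewrite ler_pdivrMr ?mulr_gt0 //.
  apply: (@le_trans _ _ (2 * (eta ^+ 2 * n ^+ 3))).
    by rewrite ler_pM2l.
  lra.
have e2 : eta * n ^+ 2 <= 1 / 100 * n ^+ 2 by rewrite ler_wpM2r ?sqr_ge0.
move=> h.
have hE' : nedge <= n ^+ 2 * (11 / 50) by nra.
have : n * nedge <= n * (n ^+ 2 * (11 / 50)) by rewrite ler_wpM2l.
have n3 : 0 < n ^+ 3 by rewrite exprn_gt0.
have := ntri_ge0; have := ncherry_ge0; move: hI; rewrite nindepE.
move=> *; nra.
Qed.

(** [ntri_ge] is applied at a good vertex of degree [d]. The error terms total at most [9 eta n^4];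
    division by [2 d >= 2 n / 5] leaves at most [(45/2) eta n^3], which the 25 covers. *)
Lemma ntri_large (theta rho eta : R) :
  theta ^+ 3 + theta ^+ 2 - theta + 1 / 6 = 0 ->
  rho = 6 * theta ^+ 2 * (1 - 2 * theta) ->
  2 / 5 <= theta -> rho < 1 / 5 ->
  0 < eta -> eta <= 1 / 100 ->
  ncherry <= eta ^+ 2 * n ^+ 3 -> nindep <= rho * n ^+ 3 -> 0 < n ->
  (rho - 25 * eta) * n ^+ 3 <= ntri.
Proof.
move=> ht hr t25 r5 e0 e1 hC hI n0.
have n3 : 0 < n ^+ 3 by rewrite exprn_gt0.
have [|v [dv cv]] := exists_good_vertex e0 e1 hC; first by nra.
have dn := deg_le v; have C0 := nonedges_in_ge0 v.
have D0 := edges_across_ge0 v; have := ntri_ge v.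
move: (deg v) (nonedges_in v) (edges_across v) dv cv dn C0 D0.
move=> d cin dac dv cv dn C0 D0 main.
have d0 : 0 < d by lra.
rewrite -(ler_pM2l (x := 2 * d)) ?mulr_gt0 //.
apply: le_trans main.
have f1 : (d - n) * (rho * n ^+ 3) <= (d - n) * nindep.
  by rewrite ler_wnM2l // subr_le0.
have f2 : 3 * n * d * cin + 6 * n * (n - d) * dac
    <= 6 * n ^+ 2 * (eta * n ^+ 2).
  have : n * d * cin <= n * n * cin by rewrite ler_wpM2r // ler_wpM2l // ltW.
  have : n * (n - d) * dac <= n * n * dac.
    by rewrite ler_wpM2r // ler_wpM2l //; lra.
  have : n ^+ 2 * (cin + dac) <= n ^+ 2 * (eta * n ^+ 2).
    by rewrite ler_wpM2l // sqr_ge0.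
  have : 0 <= n ^+ 2 * cin by rewrite mulr_ge0 ?sqr_ge0.
  lra.
have f3 : 3 * d * ncherry <= 3 * (eta * n ^+ 4).
  apply: (@le_trans _ _ (3 * (n * (eta ^+ 2 * n ^+ 3)))).
    rewrite -mulrA ler_pM2l // ler_pM ?ncherry_ge0 //; exact: ltW.
  rewrite ler_pM2l //.
  have -> : n * (eta ^+ 2 * n ^+ 3) = (eta * eta) * n ^+ 4 by ring.
  rewrite ler_wpM2r ?exprn_ge0 ?ltW //; nra.
(* By the cubic equation, theta n is a double root of the left-hand side in d. *)
have f4 : (d - n) * (rho * n ^+ 3) - d * n ^+ 3
    + 3 * n * d * (d ^+ 2 + (n - d) ^+ 2) - 2 * d * (rho * n ^+ 3)
  = 6 * n * (d - theta * n) ^+ 2 * (d - (1 - 2 * theta) * n).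
  apply/eqP; rewrite -subr_eq0; apply/eqP.
  transitivity (12 * n ^+ 3 * d *
    (theta ^+ 3 + theta ^+ 2 - theta + 1 / 6)); last by rewrite ht mulr0.
  by rewrite hr; field.
(* The last factor is non-negative because [d >= n / 5] and [1 - 2 theta <= 1 / 5]. *)
have f5 : 0 <= 6 * n * (d - theta * n) ^+ 2 * (d - (1 - 2 * theta) * n).
  apply: mulr_ge0; first by rewrite mulr_ge0 ?sqr_ge0 //; lra.
  have : 0 <= (theta - 2 / 5) * n by rewrite mulr_ge0 ?subr_ge0 // ltW.
  lra.
have f6 : n * (eta * n ^+ 3) <= 5 * d * (eta * n ^+ 3).
  by apply: ler_wpM2r; [rewrite ltW // mulr_gt0 | lra].
have f7 : 0 <= eta * n ^+ 4 by rewrite ltW // mulr_gt0 // exprn_gt0.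
lra.
Qed.

End Densities.

(** * Three-vertex graphs and ordered triples *)

Lemma exists_bij_ord3 (K : graph) :
  #|K| = 3%N -> exists g : 'I_3 -> K, bijective g.
Proof.
move=> K3; exists (fun x => enum_val (cast_ord (esym K3) x)).
exists (fun x => cast_ord K3 (enum_rank x)) => x.
  by rewrite enum_valK cast_ordKV.
by rewrite cast_ordK enum_rankK.
Qed.

(** Graphs with equally many edges are isomorphic to the same [P3]. This turns the isomorphism test
    inside [pr] into an edge count. *)
Lemma isomorphic3P (K H : graph) : #|K| = 3%N -> #|H| = 3%N ->
  isomorphic K H <-> nb_edges K = nb_edges H.
Proof.
move=> K3 H3; split=> [[f bf ef]|eKH].
  have [g bg] := exists_bij_ord3 K3.
  rewrite (nb_edgesE bg) (nb_edgesE (bij_comp bf bg)) /=.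
  by rewrite !ef.
have [f bf ef] := isomorphic_P3 K3.
have [h [h' hK h'K] eh] := isomorphic_P3 H3.
rewrite -eKH in h h' hK h'K eh.
exists (h' \o f); first by apply: bij_comp bf; exists h.
by move=> x y; rewrite -ef -eh /= !h'K.
Qed.

Lemma nb_edges_le3 (K : graph) : #|K| = 3%N -> (nb_edges K <= 3)%N.
Proof.
move=> /exists_bij_ord3[g bg]; rewrite (nb_edgesE bg).
by do 3![case: edge].
Qed.

Lemma nb_edges_induced3 (G : graph) (x y z : G) : uniq [:: x; y; z] ->
  nb_edges (Defs.induced [set x; y; z]) = (edge x y + edge x z + edge y z)%N.
Proof.
move=> uxyz; set S := [set x; y; z].
have xS : x \in S by rewrite !inE eqxx.
have yS : y \in S by rewrite !inE eqxx orbT.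
have zS : z \in S by rewrite !inE eqxx orbT.
pose g (i : 'I_3) : Defs.induced S :=
  tnth [tuple Sub x xS; Sub y yS; Sub z zS] i.
have gi : injective g.
  apply/tuple_uniqP; move: uxyz; rewrite /= !inE !andbT -!val_eqE /=.
  by [].
have bg : bijective g.
  apply: inj_card_bij => //; rewrite card_ord card_sig.
  apply: (leq_trans (subset_leq_card (_ : _ \subset S))).
    by apply/fintype.subsetP => i; rewrite inE.
  by rewrite /S -[3%N]/(size [:: x; y; z]) -(card_uniqP uxyz);
    rewrite subset_leq_card //;
    apply/fintype.subsetP => i; rewrite !inE orbA.
by rewrite (nb_edgesE bg).
Qed.

Section Triples.
Variable T : finType.

Lemma card_triples_set (S : {set T}) : #|S| = 3%N ->
  #|[pred t : T * T * T | uniq [:: t.1.1; t.1.2; t.2]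
      && ([set t.1.1; t.1.2; t.2] == S)]| = 6%N.
Proof.
move=> S3.
have [a [b [c [abc ->]]]] : exists a b c,
    uniq [:: a; b; c] /\ S = [set a; b; c].
  have := enum_uniq S; have := cardE S; rewrite S3.
  have : S =i enum S by move=> x; rewrite mem_enum.
  case: (enum S) => [|a [|b [|c [|]]]] // Se _ u.
  exists a, b, c; split => //; apply/setP => x.
  by rewrite Se !inE orbA.
pose s := [:: (a, b, c); (a, c, b); (b, a, c); (b, c, a); (c, a, b); (c, b, a)].
move: abc; rewrite /= !inE !andbT negb_or => /andP[/andP[ab ac] bc].
have us : uniq s.
  rewrite /= !inE !xpair_eqE !eqxx.
  rewrite ![b == a]eq_sym ![c == a]eq_sym ![c == b]eq_sym.
  by rewrite (negPf ab) (negPf ac) (negPf bc).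
rewrite -[6%N]/(size s) -(card_uniqP us); apply: eq_card => -[[x y] z].
rewrite inE /=; apply/andP/idP => [[]|].
  rewrite !inE negb_or !andbT => /andP[/andP[xy xz] yz] /eqP e.
  have : x \in [set a; b; c] by rewrite -e !inE eqxx.
  have : y \in [set a; b; c] by rewrite -e !inE eqxx orbT.
  have : z \in [set a; b; c] by rewrite -e !inE eqxx orbT.
  rewrite !inE -!orbA => /or3P[] /eqP ez /or3P[] /eqP ey /or3P[] /eqP ex;
  move: xy xz yz; rewrite ex ey ez ?eqxx //= => _ _ _;
  by rewrite !xpair_eqE !eqxx ?orbT.
have perm3 (p q r : T) : [set p; q; r] = [set a; b; c] ->
   p != q -> p != r -> q != r ->
   uniq [:: p; q; r] /\ [set p; q; r] == [set a; b; c].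
  move=> -> pq pr qr; rewrite eqxx; split => //.
  by rewrite /= !inE negb_or pq pr qr.
move=> xyz; suff [] : uniq [:: x; y; z] /\
  [set x; y; z] == [set a; b; c] by [].
move: xyz; rewrite /s [_ \in _]inE.
rewrite !in_cons in_nil orbF !xpair_eqE.
case/or4P => [||| /or3P[]] /andP[/andP[/eqP-> /eqP->] /eqP->];
  apply: perm3; rewrite // 1?eq_sym //; apply/setP => i; rewrite !inE;
  by case: (i == a); case: (i == b); case: (i == c).
Qed.

(** The triples are grouped by their underlying set, and each fibre consists of the six orderings of
    that set. *)
Lemma card_triples (P : pred {set T}) :
  (#|[pred t : T * T * T | uniq [:: t.1.1; t.1.2; t.2]
      && P [set t.1.1; t.1.2; t.2]]|
   = 6 * #|[set S : {set T} | (#|S| == 3) && P S]|)%N.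
Proof.
rewrite -[LHS]sum1_card (partition_big (fun t => [set t.1.1; t.1.2; t.2])
  (fun S => (#|S| == 3%N) && P S)) /=; last first.
  move=> [[x y] z] /=; rewrite inE /=.
  move=> /andP[u ->]; rewrite andbT.
  rewrite -[3%N]/(size [:: x; y; z]) -(card_uniqP (u : uniq [:: x; y; z])).
  by apply/eqP; apply: eq_card => i; rewrite !inE orbA.
rewrite (eq_bigr (fun=> 6%N)) => [|S /andP[/eqP S3 PS]].
  by rewrite sum_nat_const mulnC; rewrite cardsE.
rewrite -[RHS](card_triples_set S3) -sum1_card; apply: eq_bigl => t.
rewrite /= !inE -!andbA; do 3!congr andb.
by case: eqP => [->|]; rewrite ?PS ?andbF.
Qed.

End Triples.

Lemma eq_addn3b (p q s : bool) :
  ((p + q + s == 0)%N = [&& ~~ p, ~~ q & ~~ s]) *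
  ((p + q + s == 1)%N = [|| [&& p, ~~ q & ~~ s], [&& ~~ p, q & ~~ s]
     | [&& ~~ p, ~~ q & s]]) *
  ((p + q + s == 2)%N = [|| [&& p, q & ~~ s], [&& p, ~~ q & s]
     | [&& ~~ p, q & s]]) *
  ((p + q + s == 3)%N = [&& p, q & s]).
Proof. by case: p; case: q; case: s. Qed.

(** * Induced densities as triple counts *)

Section PrCount.
Variables (R : realType) (G : graph).
Let n : R := #|G|%:R.

Definition ncopies (i : nat) : R :=
  sum3 (fun x y z : G => (uniq [:: x; y; z]
    && (edge x y + edge x z + edge y z == i)%N)%:R).

(** The ordered count is 6 times the number of induced copies, and the same 6 turns the binomial
    coefficient into a falling factorial. *)
Lemma pr_ncopies (H : graph) : #|H| = 3%N ->
  pr R H G = ncopies (nb_edges H) / (#|G| ^_ 3)%:R.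
Proof.
move=> H3; rewrite /pr H3 -bin_ffact natrM invfM mulrCA -[LHS]mulrC.
congr (_ * _).
apply: (@mulfI _ 6); first by rewrite pnatr_eq0.
rewrite [RHS]mulrCA -[3`!]/6%N divff ?mulr1 ?pnatr_eq0 //.
rewrite -natrM -(card_triples (fun S => `[< isomorphic (Defs.induced S) H >])).
rewrite -sum1_card natr_sum big_mkcond /= /ncopies /sum3 pair_big pair_big /=.
apply: eq_bigr => -[[x y] z] _; rewrite [_ \in _]inE.
change ((if uniq [:: x; y; z]
    && `[< isomorphic (Defs.induced [set x; y; z]) H >]
  then 1 else 0) = (uniq [:: x; y; z]
    && (edge x y + edge x z + edge y z == nb_edges H)%N)%:R :> R).
case: (boolP (uniq [:: x; y; z])) => // u.
have i3 : #|Defs.induced [set x; y; z]| = 3%N.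
  rewrite card_sig -[3%N]/(size [:: x; y; z]) -(card_uniqP u).
  by apply: eq_card => i; rewrite !inE orbA.
have -> : `[< isomorphic (Defs.induced [set x; y; z]) H >]
    = (edge x y + edge x z + edge y z == nb_edges H)%N.
  rewrite -(nb_edges_induced3 u); apply/asboolP/eqP;
  by move/(isomorphic3P i3 H3).
by case: eqP.
Qed.


Variable b : bool.

(* For b = false, G is complete multipartite iff same_part is transitive;
   b = true is the same for the complement of G. *)
Definition same_part (x y : G) := (x == y) || (edge x y == b).

Lemma same_part_sym : symmetric same_part.
Proof. by move=> x y; rewrite /same_part eq_sym edge_sym. Qed.

(** The equality is exact: [same_part] is reflexive, so triples with a repeated vertex contribute
    0. *)
Lemma nindep_ncopies : nindep R same_part = ncopies (if b then 0 else 3).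
Proof.
apply: eq_sum3 => x y z; rewrite /same_part /= !inE.
have := edge_irr x; have := edge_irr y; have := edge_irr z.
case: (eqVneq x y) => [->|_]; first by rewrite subrr !mul0r.
case: (eqVneq x z) => [->|_]; first by rewrite subrr mulr0 !mul0r.
case: (eqVneq y z) => [->|_]; first by rewrite subrr mulr0.
move=> _ _ _.
by case: b; rewrite eq_addn3b; case: edge; case: edge; case: edge => /=; ring.
Qed.

Lemma ncherry_ncopies : 3 * ncherry R same_part = ncopies (if b then 2 else 1).
Proof.
rewrite -sum3_cherry; last exact: same_part_sym.
apply: eq_sum3 => x y z; rewrite /same_part /= !inE.
case: (eqVneq x y) => [->|xy] /=.
  by case: (y == z); case: (edge y z == b) => /=; ring.
case: (eqVneq x z) xy => [->|_ _] /=.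
  rewrite eq_sym (edge_sym y z) => /negPf ->; case: (edge z y == b) => /=; ring.
case: (eqVneq y z) => [->|_] /=.
  by case: (edge x z == b) => /=; ring.
by case: b; rewrite eq_addn3b; case: edge; case: edge; case: edge => /=; ring.
Qed.

Lemma ncopies_le_ntri : ncopies (if b then 3 else 0) <= ntri R same_part.
Proof.
apply: ler_sum3 => x y z; rewrite /same_part /= !inE.
case: (eqVneq x y) => [->|_] /=; first by rewrite !mulr_ge0.
case: (eqVneq x z) => [->|_] /=; first by rewrite !mulr_ge0.
case: (eqVneq y z) => [->|_] /=; first by rewrite !mulr_ge0.
by case: b; rewrite eq_addn3b; case: edge; case: edge; case: edge => /=; lra.
Qed.

(** Here triples with a repeated vertex do contribute; there are at most [n^2] of them for each of
    the three pairs of positions. *)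
Lemma ntri_le_ncopies :
  ntri R same_part <= ncopies (if b then 3 else 0) + 3 * n ^+ 2.
Proof.
have diag (x : G) : \sum_y (x == y)%:R = 1 :> R.
  rewrite (bigD1 x) //= eqxx big1 ?addr0 // => y yx.
  by rewrite eq_sym (negPf yx).
have s1 : sum3 (fun x y z : G => (y == z)%:R) = n ^+ 2 :> R.
  rewrite (eq_sum3 (g := fun x y z : G => 1 * (y == z)%:R)); last first.
    by move=> *; rewrite mul1r.
  rewrite (@sum3M _ _ (fun=> 1)) (eq_bigr (fun=> 1) (fun y _ => diag y)).
  by rewrite sumr_const -expr2.
have s2 : sum3 (fun x y z : G => (x == z)%:R) = n ^+ 2 :> R.
  by rewrite sum3C12 s1.
have s3 : sum3 (fun x y z : G => (x == y)%:R) = n ^+ 2 :> R.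
  by rewrite sum3C23 s2.
have -> : 3 * n ^+ 2
    = sum3 (fun x y z : G => (x == y)%:R + (x == z)%:R + (y == z)%:R).
  by rewrite !sum3D s1 s2 s3; ring.
rewrite -sum3D; apply: ler_sum3 => x y z.
have l1 (p q s : bool) : p%:R * q%:R * s%:R <= 1 :> R.
  by case: p; case: q; case: s; rewrite ?(mulr1, mulr0, mul0r) ?ler01.
case: (eqVneq x y) => [->|xy].
  by rewrite (le_trans (l1 _ _ _)) // -!natrD ler1n !addn_gt0 /= ?orbT.
case: (eqVneq x z) => [->|xz].
  by rewrite (le_trans (l1 _ _ _)) // -!natrD ler1n !addn_gt0 /= ?orbT.
case: (eqVneq y z) => [->|yz].
  by rewrite (le_trans (l1 _ _ _)) // -!natrD ler1n !addn_gt0 /= ?orbT.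
rewrite !addr0 /same_part (negPf xy) (negPf xz) (negPf yz) /= !inE.
rewrite (negPf xy) (negPf xz) (negPf yz).
by case: b; rewrite eq_addn3b; case: edge; case: edge; case: edge => /=; lra.
Qed.

Hypothesis n3 : (3 <= #|G|)%N.

Let n_ge3 : 3 <= n. Proof. by rewrite ler_nat. Qed.

Let ffact3 : (#|G| ^_ 3)%:R = n * (n - 1) * (n - 2) :> R.
Proof.
by rewrite !ffactnS ffactn0 muln1 -subn2 -subn1 !natrM !natrB ?mulrA //; lia.
Qed.

(** Since [n (n - 1) (n - 2) / n^3 = 1 - (3 n - 2) / n^2], replacing the falling factorial by [n^3]
    costs at most [3 / n]. *)
Lemma ncopies_pr (H : graph) : #|H| = 3%N ->
  0 <= pr R H G - ncopies (nb_edges H) / n ^+ 3 <= 3 / n.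
Proof.
move=> H3; have p1 := pr_le1 R H G; have p0 := pr_ge0 R H G.
have n0 : 0 < n by have := n_ge3; lra.
have -> : ncopies (nb_edges H) = pr R H G * (n * (n - 1) * (n - 2)).
  rewrite pr_ncopies // ffact3 divfK //.
  by rewrite !mulf_neq0 //; apply: lt0r_neq0; have := n_ge3; lra.
have -> : pr R H G - pr R H G * (n * (n - 1) * (n - 2)) / n ^+ 3
    = pr R H G * ((3 * n - 2) / n ^+ 2).
  by field; exact: lt0r_neq0.
have q0 : 0 <= (3 * n - 2) / n ^+ 2.
  by rewrite divr_ge0 ?sqr_ge0 //; have := n_ge3; lra.
have q1 : (3 * n - 2) / n ^+ 2 <= 3 / n.
  rewrite ler_pdivrMr ?exprn_gt0 // expr2 mulrA divfK ?lt0r_neq0 //.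
  by have := n_ge3; lra.
rewrite mulr_ge0 //=; apply: le_trans q1.
by rewrite -[leRHS]mul1r ler_wpM2r.
Qed.

Lemma pr_indep : 0 <= pr R (P3 (if b then 0 else 3)) G
  - nindep R same_part / n ^+ 3 <= 3 / n.
Proof.
rewrite nindep_ncopies; have := ncopies_pr (card_P33 (if b then 0 else 3)).
by rewrite nb_edges_P33 //; case: b.
Qed.

(** The errors from the normalisation and from repeated vertices are each at most [3 / n] and have
    opposite signs, so they do not add up. *)
Lemma pr_tri : `|pr R (P3 (if b then 3 else 0)) G
  - ntri R same_part / n ^+ 3| <= 3 / n.
Proof.
have n0 : 0 < n by have := n_ge3; lra.
have n30 : 0 < n ^+ 3 by rewrite exprn_gt0.
have := ncopies_pr (card_P33 (if b then 3 else 0)).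
rewrite nb_edges_P33 ?if_same //; last by case: b.
have h1 : ncopies (if b then 3 else 0) / n ^+ 3 <= ntri R same_part / n ^+ 3.
  by rewrite ler_pM2r ?invr_gt0 // ncopies_le_ntri.
have h2 : ntri R same_part / n ^+ 3
    <= ncopies (if b then 3 else 0) / n ^+ 3 + 3 / n.
  have -> : 3 / n = 3 * n ^+ 2 / n ^+ 3 by field; exact: lt0r_neq0.
  by rewrite -mulrDl ler_pM2r ?invr_gt0 // ntri_le_ncopies.
by rewrite ler_norml => /andP[h3 h4]; apply/andP; split; lra.
Qed.

Lemma ncherry_le_pr :
  ncherry R same_part <= pr R (P3 (if b then 2 else 1)) G * n ^+ 3.
Proof.
have n0 : 0 < n by have := n_ge3; lra.
have := ncopies_pr (card_P33 (if b then 2 else 1)).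
rewrite nb_edges_P33 -?ncherry_ncopies; last by case: b.
rewrite subr_ge0 ler_pdivrMr ?exprn_gt0 // => /andP[h _].
by apply: le_trans h; rewrite ler_peMl ?ncherry_ge0 // ler1n.
Qed.

End PrCount.

(** * Numerical bounds for the constants *)

Lemma largest_root_bounds (R : realType) (theta : R) :
  is_largest_root (fun x : R => x ^+ 3 + x ^+ 2 - x + 1 / 6) theta ->
  427 / 10 ^+ 3 + 372 / 10 ^+ 6 + 91 / 10 ^+ 8 <= theta
    <= 427 / 10 ^+ 3 + 372 / 10 ^+ 6 + 92 / 10 ^+ 8.
Proof.
move=> [ht hmax].
pose q : {poly R} := 'X^3 + 'X^2 - 'X + (1 / 6)%:P.
have qE x : q.[x] = x ^+ 3 + x ^+ 2 - x + 1 / 6 by rewrite /q !hornerE.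
have ab : 427 / 10 ^+ 3 + 372 / 10 ^+ 6 + 91 / 10 ^+ 8
    <= 427 / 10 ^+ 3 + 372 / 10 ^+ 6 + 92 / 10 ^+ 8 :> R by lra.
(* The cubic changes sign between 0.42737291 and 0.42737292; the root found there is at most [theta]
   by maximality. *)
have [|t /andP[t1 _] /rootP rt] := @poly_ivt R q _ _ ab.
  by rewrite !qE; apply/andP; split; lra.
rewrite qE in rt; rewrite (le_trans t1 (hmax _ rt)) /=.
(* The cubic is positive at [c], and its divided difference between [c] and [theta] is non-negative
   beyond 0.42, so no root exceeds [c]. *)
rewrite leNgt; apply/negP => th.
set c : R := 427 / 10 ^+ 3 + 372 / 10 ^+ 6 + 92 / 10 ^+ 8 in th *.
have cc : c ^+ 3 + c ^+ 2 - c + 1 / 6 > 0 by rewrite /c; lra.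
have c1 : 42 / 100 <= c by rewrite /c; lra.
have /= ht' := ht.
have : (theta - c) * (theta ^+ 2 + theta * c + c ^+ 2 + theta + c - 1) < 0.
  by lra.
have : 0 <= (theta - c) * (theta ^+ 2 + theta * c + c ^+ 2 + theta + c - 1).
  by rewrite mulr_ge0 ?subr_ge0 ?ltW //; nra.
by rewrite leNgt => /negP.
Qed.

Lemma rho_bounds (R : realType) (theta : R) :
  427 / 10 ^+ 3 + 372 / 10 ^+ 6 + 91 / 10 ^+ 8 <= theta
    <= 427 / 10 ^+ 3 + 372 / 10 ^+ 6 + 92 / 10 ^+ 8 ->
  159 / 10 ^+ 3 + 181 / 10 ^+ 6 <= 6 * theta ^+ 2 * (1 - 2 * theta)
    < 159 / 10 ^+ 3 + 182 / 10 ^+ 6.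
Proof.
move=> /andP[t1 t2].
(* Expanding around the lower endpoint makes the claim linear in [e], [e^2] and [e^3], with the
   higher powers negligible. *)
have [e -> /andP[e1 e2]] : exists2 e : R,
    theta = (427 / 10 ^+ 3 + 372 / 10 ^+ 6 + 91 / 10 ^+ 8) + e
    & 0 <= e <= 1 / 10 ^+ 8.
  exists (theta - (427 / 10 ^+ 3 + 372 / 10 ^+ 6 + 91 / 10 ^+ 8));
    first by rewrite addrC subrK.
  by apply/andP; split; lra.
have e3 : 0 <= e ^+ 2 by rewrite sqr_ge0.
have e4 : e ^+ 2 <= 1 / 10 ^+ 8 * e by rewrite expr2 ler_wpM2r.
have e5 : 0 <= e ^+ 3 by rewrite exprn_ge0.
have e6 : e ^+ 3 <= 1 / 10 ^+ 8 * e ^+ 2 by rewrite exprS ler_wpM2r.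
by apply/andP; split; lra.
Qed.

(** * Density inequalities for a single finite graph *)

Section FiniteVersions.
Variables (R : realType) (G : graph).
Let n : R := #|G|%:R.
Hypothesis n3 : (3 <= #|G|)%N.

Let n_gt0 : 0 < n. Proof. by rewrite ltr0n; apply: leq_trans n3. Qed.

Lemma pr_goodman : 1 / 4 - 6 / n <= pr R (P3 0) G + pr R (P3 3) G.
Proof.
have := pr_tri R false n3; have := pr_indep R false n3.
rewrite -/n ler_norml => /andP[i1 i2] /andP[t1 t2].
have n30 : 0 < n ^+ 3 by rewrite exprn_gt0.
have : 1 / 4 <= (nindep R (same_part (G:=G) false)
   + ntri R (same_part (G:=G) false)) / n ^+ 3.
  rewrite ler_pdivlMr //; have := goodman R (@same_part_sym G false).
  by rewrite -/n; lra.
by rewrite mulrDl; lra.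
Qed.

(** By contradiction with [ntri_large] for [eta = delta / 100]: its loss [25 eta = delta / 4] and
    the error [3 / n <= delta / 10] together stay below the gap [delta]. *)
Lemma pr_cherry_ge (b : bool) (theta rho delta : R) :
  theta ^+ 3 + theta ^+ 2 - theta + 1 / 6 = 0 ->
  rho = 6 * theta ^+ 2 * (1 - 2 * theta) -> 2 / 5 <= theta -> rho < 1 / 5 ->
  0 < delta -> delta <= 1 -> 3 / n <= delta / 10 ->
  pr R (P3 0) G <= rho - delta -> pr R (P3 3) G <= rho - delta ->
  (delta / 100) ^+ 2 <= pr R (P3 (if b then 2 else 1)) G.
Proof.
move=> ht hr t25 r5 d0 d1 nd p0 p3; rewrite leNgt; apply/negP => hC.
have n30 : 0 < n ^+ 3 by rewrite exprn_gt0.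
have sym := @same_part_sym G b.
have := pr_tri R b n3; have := pr_indep R b n3.
rewrite -/n ler_norml => /andP[i1 i2] /andP[t1 t2].
have pi : pr R (P3 (if b then 0 else 3)) G <= rho - delta.
  by case: b {hC sym i1 i2 t1 t2}.
have pt : pr R (P3 (if b then 3 else 0)) G <= rho - delta.
  by case: b {hC sym i1 i2 t1 t2 pi}.
have hc : ncherry R (same_part (G:=G) b) <= (delta / 100) ^+ 2 * n ^+ 3.
  apply: (le_trans (ncherry_le_pr R b n3)).
  by rewrite ler_pM2r // ltW.
have hI : nindep R (same_part (G:=G) b) <= rho * n ^+ 3.
  by rewrite -ler_pdivrMr //; lra.
have e0 : 0 < delta / 100 by lra.
have e1 : delta / 100 <= 1 / 100 by lra.
have := ntri_large sym ht hr t25 r5 e0 e1 hc hI n_gt0.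
rewrite -/n -ler_pdivlMr //; lra.
Qed.

End FiniteVersions.

(** * Complete tripartite graphs *)

Section Tripartite.
Variables a b c : nat.

Let V : finType := ('I_a + 'I_b + 'I_c)%type.

Definition part (x : V) : nat :=
  match x with inl (inl _) => 0 | inl (inr _) => 1 | inr _ => 2 end.

Let tedge (x y : V) := part x != part y.
Let tedge_sym : symmetric tedge.
Proof. by move=> x y; rewrite /tedge eq_sym. Qed.
Let tedge_irr : irreflexive tedge.
Proof. by move=> x; rewrite /tedge eqxx. Qed.

Definition tripartite := Graph tedge_sym tedge_irr.

Lemma card_tripartite : #|tripartite| = (a + b + c)%N.
Proof. by rewrite !card_sum !card_ord. Qed.

Lemma same_part_tripartite (x y : tripartite) :
  same_part false x y = (part x == part y).
Proof.
rewrite /same_part /= /tedge; case: (eqVneq x y) => [->|_].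
  by rewrite eqxx.
by case: (part x == part y).
Qed.

Variable R : realType.

Let sum_part (F : nat -> R) : \sum_(x : tripartite) F (part x)
  = a%:R * F 0%N + b%:R * F 1%N + c%:R * F 2%N.
Proof.
rewrite big_sumType big_sumType /= !sumr_const !card_ord.
by rewrite !mulr_natl.
Qed.

Lemma ncherry_tripartite : ncherry R (same_part (G:=tripartite) false) = 0.
Proof.
rewrite /ncherry (eq_sum3 (g := fun _ _ _ => 0)) ?sum3_cst ?mulr0 // => x y z.
rewrite !same_part_tripartite; case: eqP => [->|_]; last by rewrite !mul0r.
by case: eqP; rewrite ?subrr ?mulr0 ?mul0r.
Qed.

(** The size of the part numbered [i]. *)
Let d i : R := a%:R * (i == 0%N)%:R + b%:R * (i == 1%N)%:R
  + c%:R * (i == 2%N)%:R.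

Let dE (x : tripartite) :
  \sum_(y : tripartite) (part x == part y)%:R = d (part x).
Proof. by rewrite (sum_part (fun i => (part x == i)%:R)). Qed.

Lemma ntri_tripartite : ntri R (same_part (G:=tripartite) false)
  = a%:R ^+ 3 + b%:R ^+ 3 + c%:R ^+ 3.
Proof.
transitivity (\sum_(x : tripartite) d (part x) ^+ 2).
  apply: eq_bigr => x _; rewrite expr2 -dE mulr_suml.
  apply: eq_bigr => y _; rewrite mulr_sumr; apply: eq_bigr => z _.
  rewrite !same_part_tripartite; case: eqP => [->|_]; last by rewrite !mul0r.
  by case: eqP; rewrite ?mulr1 ?mulr0.
rewrite (sum_part (fun i => d i ^+ 2)) /d /=; ring.
Qed.

(** In [nindepE] the counts are power sums of the part sizes, so this is Newton's identity for the
    third elementary symmetric function. *)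
Lemma nindep_tripartite : nindep R (same_part (G:=tripartite) false)
  = 6 * (a%:R * b%:R * c%:R).
Proof.
rewrite nindepE; last exact: same_part_sym.
rewrite ncherry_tripartite ntri_tripartite card_tripartite !natrD.
have -> : nedge R (same_part (G:=tripartite) false)
    = a%:R ^+ 2 + b%:R ^+ 2 + c%:R ^+ 2.
  transitivity (\sum_(x : tripartite) d (part x)).
    apply: eq_bigr => x _; rewrite -dE.
    by apply: eq_bigr => y _; rewrite same_part_tripartite.
  rewrite (sum_part d) /d /=; ring.
ring.
Qed.

End Tripartite.

Local Open Scope classical_set_scope.
Local Open Scope ring_scope.

(** * Upper and lower limits, and rounding *)

Section Limits.
Variable R : realType.
Implicit Type u : nat -> R.

Let bounded01 u : (forall n, 0 <= u n <= 1) -> bounded_fun (u : nat -> R^o).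
Proof.
move=> u01; exists 1; split; first exact: num_real.
move=> M M1 n _; have /andP[u0 u1] := u01 n.
by rewrite /= ger0_norm // (le_trans u1) // ltW.
Qed.

(** The upper limit is the infimum of the tail suprema, so one of these is already below [l]; [d] is
    the gap it leaves. *)
Lemma limn_sup_lt u (l : R) : (forall n, 0 <= u n <= 1) ->
  limn_sup u < l -> exists2 d, 0 < d & \forall n \near \oo, u n <= l - d.
Proof.
move=> u01 ul; have bu := bounded01 u01.
move: ul; rewrite limn_supE // => /inf_lt[|_ [N _ <-] sl].
  by exists (sups u 0%N); exists 0%N.
exists (l - sups u N); first by rewrite subr_gt0.
exists N => // n /= Nn; rewrite opprB addrCA subrr addr0.
apply: ub_le_sup; last by exists n.
exact/has_ubound_sdrop/bounded_fun_has_ubound.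
Qed.

Lemma limn_inf_ge u (e : R) : (forall n, 0 <= u n <= 1) ->
  (\forall n \near \oo, e <= u n) -> e <= limn_inf u.
Proof.
move=> u01 [N _ eu]; have bu := bounded01 u01.
rewrite limn_infE //; apply: (@le_trans _ _ (infs u N)).
  apply: lb_le_inf; first by exists (u N); exists N => /=.
  by move=> _ [n /= Nn <-]; exact: eu.
apply: ub_le_sup; last by exists N.
exists 1 => _ [n _ <-]; apply: (@le_trans _ _ (u n)).
  apply: ge_inf; last by exists n => /=.
  exact/has_lbound_sdrop/bounded_fun_has_lbound.
by have /andP[] := u01 n.
Qed.

Lemma cvg_inv_nat : (fun n : nat => n%:R^-1 : R) @ \oo --> (0 : R).
Proof.
rewrite -(cvg_shiftS (fun n : nat => n%:R^-1 : R)); exact: cvg_harmonic.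
Qed.

Lemma cvg_trunc_div (t : R) : 0 <= t ->
  (fun n : nat => (Num.trunc (t * n%:R))%:R / n%:R : R) @ \oo --> t.
Proof.
move=> t0; refine (@squeeze_cvgr _ _ _ _ (fun n : nat => t - n%:R^-1)
  (fun=> t) _ _ t _ _).
- exists 1%N => // n /= n1.
  have n0 : 0 < n%:R :> R by rewrite ltr0n.
  have /truncn_itv /andP[h1 h2] : 0 <= t * n%:R by rewrite mulr_ge0.
  rewrite ler_pdivlMr // ler_pdivrMr // h1 andbT mulrBl mulVf ?lt0r_neq0 //.
  by rewrite lerBlDr natr1 ltW.
- rewrite -[X in _ --> X]subr0; apply: cvgB;
    [exact: cvg_cst|exact: cvg_inv_nat].
- exact: cvg_cst.
Qed.

Lemma cvg_near_approx u (v w : nat -> R) (l : R) : v @ \oo --> l ->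
  w @ \oo --> (0 : R) ->
  (\forall n \near \oo, `|u n - v n| <= w n) -> u @ \oo --> l.
Proof.
move=> vl w0 h.
refine (@squeeze_cvgr _ _ _ _ (v \- w) (v \+ w) _ _ l _ _).
- by apply: filterS h => n; rewrite ler_distl.
- by rewrite -[l]subr0; apply: cvgB.
- by rewrite -[l]addr0; apply: cvgD.
Qed.

End Limits.

(** Complete tripartite graphs on [n] vertices with two parts of size [theta n] rounded down. They
    have no induced [P3 1], since lying in the same part is transitive. *)
Lemma extremal_sequence (R : realType) (theta rho : R) :
  theta ^+ 3 + theta ^+ 2 - theta + 1 / 6 = 0 ->
  rho = 6 * theta ^+ 2 * (1 - 2 * theta) -> 0 <= theta -> 2 * theta <= 1 ->
  exists G : nat -> graph,
    [/\ #|G n| @[n --> \oo] --> \oo ,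
        pr R (P3 0) (G n) @[n --> \oo] --> rho ,
        pr R (P3 3) (G n) @[n --> \oo] --> rho
      & forall n, (3 <= #|G n|)%N -> pr R (P3 1) (G n) = 0].
Proof.
move=> ht hr t0 t1; pose k n := Num.trunc (theta * n%:R).
pose G n := tripartite (k n) (k n) (n - (k n + k n)).
have k2 n : (k n + k n <= n)%N.
  have /truncn_itv /andP[h _] : 0 <= theta * n%:R by rewrite mulr_ge0.
  rewrite -(ler_nat R) natrD (le_trans (lerD h h)) //.
  by rewrite -[leRHS]mul1r -mulrDl ler_wpM2r // -mulr2n -mulr_natl.
have Gn n : #|G n| = n by rewrite card_tripartite subnKC.
pose x n : R := (k n)%:R / n%:R.
have xt : x @ \oo --> theta by exact: cvg_trunc_div.
have yE n : (0 < n)%N -> (n - (k n + k n))%:R / n%:R = 1 - 2 * x n :> R.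
  move=> n0; rewrite natrB ?k2 // natrD /x mulrBl divff ?mulrDl; first by ring.
  by rewrite pnatr_eq0 -lt0n.
have w0 : (fun n : nat => 3 / n%:R : R) @ \oo --> (0 : R).
  by rewrite -[0](mulr0 (3 : R)); apply: cvgMr; exact: cvg_inv_nat.
have y1 : (fun n => 1 - 2 * x n) @ \oo --> 1 - 2 * theta.
  by apply: cvgB; [exact: cvg_cst|exact: cvgMr].
have cvgX (f : nat -> R) (l : R) (m : nat) : f @ \oo --> l ->
    (fun n => f n ^+ m) @ \oo --> l ^+ m.
  move=> fl; elim: m => [|m IH]; first by rewrite expr0; exact: cvg_cst.
  rewrite exprS; under eq_fun do rewrite exprS.
  exact: cvgM.
exists G; split.
- by under eq_fun do rewrite Gn; exact: cvg_id.
- apply: (@cvg_near_approx _ _ (fun n => 2 * x n ^+ 3 + (1 - 2 * x n) ^+ 3)).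
  (* The difference of the two sides is 6 times the cubic: this is where the root makes the limits
     of [p_0] and [p_3] agree. *)
  + have -> : rho = 2 * theta ^+ 3 + (1 - 2 * theta) ^+ 3 by lra.
    by apply: cvgD; [apply: cvgMr|]; exact: cvgX.
  + exact: w0.
  + exists 3%N => // n /= n3.
    have n0 : n%:R != 0 :> R by rewrite pnatr_eq0; lia.
    have := @pr_tri R (G n) false; rewrite Gn => /(_ n3).
    rewrite ntri_tripartite -yE; last by lia.
    set m := (n - _)%N.
    suff -> : 2 * x n ^+ 3 + (m%:R / n%:R) ^+ 3
      = ((k n)%:R ^+ 3 + (k n)%:R ^+ 3 + m%:R ^+ 3) / n%:R ^+ 3 by [].
    by rewrite /x; field.
- apply: (@cvg_near_approx _ _ (fun n => 6 * (x n ^+ 2 * (1 - 2 * x n)))).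
  + rewrite hr -mulrA; apply: cvgMr; apply: cvgM; [exact: cvgX|exact: y1].
  + exact: w0.
  + exists 3%N => // n /= n3.
    have n0 : n%:R != 0 :> R by rewrite pnatr_eq0; lia.
    have := @pr_indep R (G n) false; rewrite Gn => /(_ n3) /andP[h1 h2].
    rewrite -yE; last by lia.
    move: h1 h2; rewrite nindep_tripartite => h1 h2.
    have -> : 6 * (x n ^+ 2 * ((n - (k n + k n))%:R / n%:R))
        = 6 * ((k n)%:R * (k n)%:R * (n - (k n + k n))%:R) / n%:R ^+ 3 :> R.
      by rewrite /x; field.
    by rewrite ger0_norm.
- move=> n n3.
  have [e] : nb_edges (P3 1) = 1%N by rewrite nb_edges_P33.
  by rewrite pr_ncopies ?card_P33 // e -(ncherry_ncopies R _ false)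
     ncherry_tripartite mulr0 mul0r.
Qed.

Theorem mainTheorem1 (R : realType) (theta rho : R)
    (htheta : is_largest_root
                (fun x : R => x ^+ 3 + x ^+ 2 - x + 1 / 6) theta)
    (hrho : rho = 6 * theta ^+ 2 * (1 - 2 * theta)) :
  [/\ `|theta - (427 / 10 ^+ 3 + 373 / 10 ^+ 6)| < 1 / 10 ^+ 6 ,
      `|rho - (159 / 10 ^+ 3 + 181 / 10 ^+ 6)| < 1 / 10 ^+ 6 ,
      forall G : nat -> graph,
        #|G n| @[n --> \oo] --> \oo ->
        limn_sup (fun n => pr R (P3 0) (G n)) < rho ->
        limn_sup (fun n => pr R (P3 3) (G n)) < rho ->
        universal R 3 G
    & exists G : nat -> graph,
        [/\ #|G n| @[n --> \oo] --> \oo ,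
            pr R (P3 0) (G n) @[n --> \oo] --> rho ,
            pr R (P3 3) (G n) @[n --> \oo] --> rho
          & ~ universal R 3 G]].
Proof.
have tb := largest_root_bounds htheta.
have [ht _] := htheta; rewrite /= in ht.
have := rho_bounds tb; rewrite -hrho => rb.
have {tb} /andP[t1 t2] := tb; have {rb} /andP[r1 r2] := rb.
have pr01 H (G : nat -> graph) n : 0 <= pr R H (G n) <= 1.
  by rewrite pr_ge0 pr_le1.
split.
- by rewrite ltr_norml; apply/andP; split; lra.
- by rewrite ltr_norml; apply/andP; split; lra.
- move=> G Goo s0 s3 H H3.
  have [d0 d0_gt0 h0] := limn_sup_lt (pr01 (P3 0) G) s0.
  have [d3 d3_gt0 h3] := limn_sup_lt (pr01 (P3 3) G) s3.
  (* A common gap for both densities, capped at 1 as [pr_cherry_ge] requires. *)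
  pose d := Num.min 1 (Num.min d0 d3).
  have d_gt0 : 0 < d by rewrite !lt_min ltr01 d0_gt0.
  have d_le1 : d <= 1 by rewrite ge_min lexx.
  have d_le0 : d <= d0 by rewrite !ge_min lexx orbT.
  have d_le3 : d <= d3 by rewrite !ge_min lexx !orbT.
  (* With at least [N] vertices the error [3 / #|G n|] is at most [d / 10]. *)
  pose N := (Num.trunc (30 / d)).+1.
  have hN : 30 / d < N%:R.
    by have /truncn_itv/andP[] : 0 <= 30 / d by rewrite divr_ge0 // ltW.
  apply: (@lt_le_trans _ _ ((d / 100) ^+ 2)).
    by rewrite exprn_gt0 // divr_gt0.
  apply: limn_inf_ge; first exact: pr01.
  (* The additional 300 brings the error [6 / #|G n|] in Goodman's bound down to [2 / 100]. *)
  have GN : \forall n \near \oo, (N + 300 <= #|G n|)%N.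
    by move/cvgnyPge: Goo; exact.
  near=> n.
  have nN : (N + 300 <= #|G n|)%N by near: n.
  have p0 : pr R (P3 0) (G n) <= rho - d0 by near: n.
  have p3 : pr R (P3 3) (G n) <= rho - d3 by near: n.
  have G3 : (3 <= #|G n|)%N.
    by apply: leq_trans nN; apply: leq_trans (leq_addl _ _).
  have n_gt0 : 0 < #|G n|%:R :> R by rewrite ltr0n; exact: leq_trans G3.
  have nN' : N%:R + 300 <= #|G n|%:R :> R by rewrite -natrD ler_nat.
  have h3n : 3 / #|G n|%:R <= d / 10.
    rewrite ler_pdivrMr //; move: hN; rewrite ltr_pdivrMr // => hN.
    have : d * (N%:R + 300) <= d * #|G n|%:R by rewrite ler_pM2l.
    lra.
  have h6n : 6 / #|G n|%:R <= 2 / 100 :> R.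
    have N0 : 0 <= N%:R :> R by [].
    by rewrite ler_pdivrMr //; lra.
  have -> : pr R H (G n) = pr R (P3 (nb_edges H)) (G n).
    rewrite !pr_ncopies ?card_P33 // nb_edges_P33 //; exact: nb_edges_le3.
  (* For 0 or 3 edges: as [rho < 0.16], each of [p_0] and [p_3] is at least
     [1/4 - 2/100 - rho > 1/100]. *)
  have gd := @pr_goodman R _ G3.
  have small : (d / 100) ^+ 2 <= 1 / 100.
    by rewrite expr2; nra.
  have ch b : (d / 100) ^+ 2 <= pr R (P3 (if b then 2 else 1)) (G n).
    apply: (pr_cherry_ge G3 b ht hrho) => //; lra.
  have := nb_edges_le3 H3; case: (nb_edges H) => [|[|[|[|//]]]] _.
  + lra.
  + exact: (ch false).
  + exact: (ch true).
  + lra.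
- have [||G [Goo G0 G3 G1]] := extremal_sequence ht hrho; [lra|lra|].
  exists G; split => // /(_ (P3 1) (card_P33 1)).
  (* The density of [P3 1] is eventually 0, so its lower limit is 0. *)
  have -> : limn_inf (fun n => pr R (P3 1) (G n)) = 0; last by rewrite ltxx.
  have [] // := @cvg_limn_inf_sup R (fun n => pr R (P3 1) (G n)) 0.
  apply: cvg_near_cst; move/cvgnyPge: Goo => /(_ 3%N).
  by apply: filterS => n /G1.
Unshelve. all: by end_near.
Qed.
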